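(* The first-order theory $SAPP$ is $\omega$-categorical.
   Context: Let $\mathcal{L}$ be the first-order language with a binary predicate symbol $O$ (meaning perpendicularity of lines) and equality $=$ (interpreted as true equality), without constants and function symbols. $SAPP$ is the theory in $\mathcal{L}$ consisting of the following formulas: $\lambda_{1n}$ (for each $n\ge 1$): $\forall y_1\ldots\forall y_n\forall s\,(O(s,y_1)\wedge\ldots\wedge O(s,y_n)\rightarrow\exists t\,(t\neq y_1\wedge\ldots\wedge t\neq y_n\wedge O(s,t)))$; $\lambda_{2n}$ (for each $n\ge 2$): $\forall y_1\ldots\forall y_n\exists s\,(\neg O(s,y_1)\wedge\ldots\wedge\neg O(s,y_n))$; $\lambda_3$: $\forall x\,\neg O(x,x)$; $\lambda_4$: $\forall x\forall y\,(O(x,y)\rightarrow O(y,x))$; $\lambda_5$: $\forall x\exists y\,O(x,y)$; $\lambda_6$: $\forall x\forall y\forall z\forall t\,(O(x,z)\wedge O(y,z)\wedge O(x,t)\rightarrow O(y,t))$. *)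

(* Defs.v *)
From mathcomp Require Import all_boot.

Set Implicit Arguments.
Unset Strict Implicit.
Unset Printing Implicit Defensive.

(* First-order formulas with equality over one binary predicate symbol O.
   Variables are named by natural numbers. *)
Inductive formula : Type :=
| fEq  of nat & nat
| fO   of nat & nat
| fNeg of formula
| fAnd of formula & formula
| fOr  of formula & formula
| fImp of formula & formula
| fAll of nat & formula
| fEx  of nat & formula.

Record structure : Type := Structure {
  carrier :> Type;
  perp : carrier -> carrier -> Prop
}.

Definition update (A : Type) (v : nat -> A) (i : nat) (a : A) : nat -> A :=
  fun j => if j == i then a else v j.

Fixpoint sat (M : structure) (v : nat -> M) (p : formula) : Prop :=
  match p with
  | fEq i j  => v i = v j
  | fO i j   => perp (v i) (v j)
  | fNeg q   => ~ sat v q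
  | fAnd q r => sat v q /\ sat v r
  | fOr q r  => sat v q \/ sat v r
  | fImp q r => sat v q -> sat v r
  | fAll i q => forall a : M, sat (update v i a) q
  | fEx i q  => exists a : M, sat (update v i a) q
  end.

Definition theory : Type := formula -> Prop.

(* Axioms with free variables would be read as their universal closures. *)
Definition models (M : structure) (T : theory) : Prop :=
  forall p, T p -> forall v : nat -> M, sat v p.

Definition isomorphic (M N : structure) : Prop :=
  exists f : M -> N,
    bijective f /\ forall x y : M, perp x y <-> perp (f x) (f y).

Definition card_omega (M : structure) : Prop :=
  exists f : nat -> M, bijective f.

(* Exactly one model of cardinality omega, up to isomorphism. *)
Definition omega_categorical (T : theory) : Prop :=
  (exists M : structure, card_omega M /\ models M T) /\
  (forall M N : structure, card_omega M -> models M T ->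
     card_omega N -> models N T -> isomorphic M N).

(* [alls n p] is (forall y_1 ... forall y_n, p), the variable y_i being i. *)
Definition alls (n : nat) (p : formula) : formula := foldr fAll p (iota 1 n).

(* [conjs n F] is F 1 /\ ... /\ F n; it is meaningful only for n >= 1. *)
Definition conjs (n : nat) (F : nat -> formula) : formula :=
  foldl fAnd (F 1) [seq F i | i <- iota 2 n.-1].

(* In [lambda1] and [lambda2] the variable s is 0; in [lambda1] t is n.+1. *)
Definition lambda1 (n : nat) : formula :=
  alls n (fAll 0 (fImp (conjs n (fun i => fO 0 i))
    (fEx n.+1 (fAnd (conjs n (fun i => fNeg (fEq n.+1 i))) (fO 0 n.+1))))).

Definition lambda2 (n : nat) : formula :=
  alls n (fEx 0 (conjs n (fun i => fNeg (fO 0 i)))).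

Definition lambda3 : formula := fAll 0 (fNeg (fO 0 0)).

Definition lambda4 : formula := fAll 0 (fAll 1 (fImp (fO 0 1) (fO 1 0))).

Definition lambda5 : formula := fAll 0 (fEx 1 (fO 0 1)).

(* The variables x, y, z, t are 0, 1, 2, 3. *)
Definition lambda6 : formula :=
  fAll 0 (fAll 1 (fAll 2 (fAll 3
    (fImp (fAnd (fAnd (fO 0 2) (fO 1 2)) (fO 0 3)) (fO 1 3))))).

Inductive SAPP : theory :=
| SAPP1 n of 1 <= n : SAPP (lambda1 n)
| SAPP2 n of 2 <= n : SAPP (lambda2 n)
| SAPP3 : SAPP lambda3
| SAPP4 : SAPP lambda4
| SAPP5 : SAPP lambda5
| SAPP6 : SAPP lambda6.

(* Main.v *)
From mathcomp Require Import all_boot.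
From Stdlib Require Import ClassicalEpsilon.
From Stdlib Require List.
Require Import Defs.

Set Implicit Arguments.
Unset Strict Implicit.
Unset Printing Implicit Defensive.

(** Call two lines parallel when they have a common perpendicular.  In a model
    of [SAPP] this is an equivalence relation, and the lines perpendicular to a
    given line form exactly one class; hence perpendicularity pairs the classes
    off two by two.  The schema [lambda1] makes every class infinite, and
    [lambda2] makes the set of classes infinite.  A countable model is
    therefore determined: it consists of infinitely many pairs of countably
    infinite classes.

    Uniqueness is obtained by the back-and-forth method ([back_and_forth]).
    The finite partial maps used are those which preserve and reflect equality,
    perpendicularity and parallelism ([partial_iso]); parallelism has to be
    imposed because a common perpendicular of two lines need not be in the
    domain.  Such a map extends to a new line [a] ([partial_iso_forth]) in one
    of two ways.  When [a] is perpendicular to a line [a0] of the domain, its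
    relations to all other lines are determined by those of [a0], so any fresh
    perpendicular to the image of [a0] may serve as image of [a].  When [a] is
    neither perpendicular nor parallel to a line of the domain, any line of the
    other model in the same position will do.  If [a] is only parallel to
    a line of the domain, a perpendicular to [a] is added first.

    For existence, the class of [n] in the model on the natural numbers is the
    2-adic valuation of [n.+1], and the classes [2k] and [2k+1] are
    perpendicular. *)

(** * Satisfaction of the derived connectives *)

Lemma sat_conjs (M : structure) (v : nat -> M) n (F : nat -> formula) :
  0 < n -> sat v (conjs n F) <-> (forall i, 0 < i <= n -> sat v (F i)).
Proof.
have fold_sat s p : sat v (foldl fAnd p [seq F i | i <- s]) <->
    sat v p /\ (forall i, i \in s -> sat v (F i)).
  elim: s p => [|j s IHs] p /=; first by split=> [|[]].
  split=> [/IHs /= [[vp vj] vs]|[vp vs]].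
    by split=> // i; rewrite inE => /orP[/eqP->|/vs].
  apply/IHs; split=> /=; first by split=> //; apply: vs; rewrite mem_head.
  by move=> i i_s; apply: vs; rewrite inE i_s orbT.
case: n => // n _; split=> [/fold_sat[v1 vs] i|vF].
  case/andP=> i_gt0 le_in; case: (eqVneq i 1) => [-> //|i_neq1].
  by apply: vs; rewrite mem_iota add2n ltnS le_in andbT ltn_neqAle eq_sym i_neq1.
apply/fold_sat; split=> [|i]; first exact: vF.
by rewrite mem_iota add2n ltnS => /andP[/ltnW i_gt0 le_in]; apply: vF; apply/andP.
Qed.

Lemma sat_alls_intro (M : structure) (v : nat -> M) n p :
  (forall w : nat -> M, sat w p) -> sat v (alls n p).
Proof.
move=> Hp; rewrite /alls; elim: (iota 1 n) v => [|i s IHs] v //=.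
Qed.

Lemma sat_alls_elim (M : structure) (v u : nat -> M) n p :
  sat v (alls n p) ->
  exists2 w : nat -> M, sat w p & forall i, 0 < i <= n -> w i = u i.
Proof.
suff gen k m (v0 : nat -> M) : sat v0 (foldr fAll p (iota m k)) ->
    exists2 w : nat -> M, sat w p &
      forall i, w i = if m <= i < m + k then u i else v0 i.
  by case/gen=> w wp Hw; exists w => // i Hi; rewrite Hw add1n ltnS Hi.
elim: k m v0 => [|k IHk] m v0 /=.
  by exists v0 => // i; rewrite addn0 ltnNge andbN.
move=> /(_ (u m)) /IHk [w wp Hw]; exists w => // i.
rewrite Hw /update addSnnS; case: ltngtP => //= <-.
by rewrite addnS ltnS leq_addr.
Qed.

(** * Perpendicularity and parallelism in models *)

(** What the axioms of [SAPP] say semantically.  Finite lists replace the tuples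
    of variables, and may be empty and contain any lines, which makes
    [perp_fresh] subsume [lambda5] as well as the schema [lambda1]. *)
Record perp_space (M : structure) : Prop := PerpSpace {
  perp_fresh : forall (s : M) (l : seq M), exists2 t, perp s t & ~ List.In t l;
  perp_avoid : forall l : seq M, exists s : M, forall y, List.In y l -> ~ perp s y;
  perp_irr : forall x : M, ~ perp x x;
  perp_sym : forall x y : M, perp x y -> perp y x;
  perp_trans : forall x y z t : M, perp x z -> perp y z -> perp x t -> perp y t
}.

Lemma In_nth (A : Type) (x0 x : A) (l : seq A) :
  List.In x l -> exists2 i, i < size l & nth x0 l i = x.
Proof.
elim: l => [|y l IHl] //= [->|/IHl[i lt_il <-]]; first by exists 0.
by exists i.+1.
Qed.

Lemma models_perp_space (M : structure) :
  card_omega M -> models M SAPP -> perp_space M.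
Proof.
case=> v _ satM.
have perp_ex (x : M) : exists y, perp x y := satM _ SAPP5 v x.
split.
- move=> s l; have [y0 sy0] := perp_ex s.
  (* [lambda1] only speaks of perpendiculars to [s]: the other entries of [l]
     are replaced by [y0], which also makes the tuple nonempty. *)
  pose u i := let y := nth y0 l i.-1 in
    if excluded_middle_informative (perp s y) then y else y0.
  have su i : perp s (u i) by rewrite /u; case: excluded_middle_informative.
  have [w sat_w wu] :=
    sat_alls_elim u (satM _ (@SAPP1 (size l).+1 isT) v).
  have perp_s : sat (update w 0 s) (conjs (size l).+1 (fO 0)).
    apply/sat_conjs => // i Hi /=; rewrite /update /=.
    by case: eqP Hi => [-> //|_ Hi]; rewrite wu.
  have [t [sat_neq]] := sat_w s perp_s.
  have neq := proj1 (sat_conjs _ _ (ltn0Sn _)) sat_neq.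
  rewrite /= /update !eqxx /= => st; exists t => // /(In_nth y0).
  case=> i lt_il def_t; have lt_iSl : i < (size l).+1 := ltnW lt_il.
  have /= := neq i.+1 lt_iSl.
  rewrite /update !eqxx /= eqSS ltn_eqF // wu // /u /= def_t.
  by case: excluded_middle_informative.
- (* [lambda2] starts at two variables, hence the padding. *)
  move=> l; pose l2 := [:: v 0, v 0 & l].
  have [w [s /sat_conjs sat_s] wu] :=
    sat_alls_elim (fun i => nth (v 0) l2 i.-1) (satM _ (@SAPP2 (size l2) isT) v).
  exists s => y l_y; have /(In_nth (v 0)) [i lt_i <-] : List.In y l2 by right; right.
  have /= := sat_s isT i.+1 lt_i; rewrite /update /= wu //.
- by move=> x; apply: (satM _ SAPP3 v x).
- by move=> x y; apply: (satM _ SAPP4 v x y).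
- by move=> x y z t xz yz xt; apply: (satM _ SAPP6 v x y z t).
Qed.

Definition parallel (M : structure) (x y : M) : Prop :=
  exists2 z, perp x z & perp y z.

Section PerpSpaceTheory.

Variables (M : structure) (spaceM : perp_space M).

Lemma perp_ex (x : M) : exists y, perp x y.
Proof. by have [y] := perp_fresh spaceM x [::]; exists y. Qed.

Lemma perpC (x y : M) : perp x y <-> perp y x.
Proof. by split; apply: perp_sym. Qed.

Lemma parallel_refl (x : M) : parallel x x.
Proof. by have [z] := perp_ex x; exists z. Qed.

Lemma parallelC (x y : M) : parallel x y <-> parallel y x.
Proof. by split=> -[z]; exists z. Qed.

Lemma perp_parallel (x y z : M) : parallel x y -> perp x z -> perp y z.
Proof. by case=> t xt yt; apply: (perp_trans spaceM xt yt). Qed.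

(** The lines perpendicular to [x] form the class of [x0], and those
    perpendicular to [x0] form the class of [x]: the position of [x] is
    determined by that of a single perpendicular. *)
Lemma perp_position (x x0 y : M) : perp x x0 ->
  (perp x y <-> parallel x0 y) /\ (parallel x y <-> perp x0 y).
Proof.
move=> x_x0; have x0_x := perp_sym spaceM x_x0.
split; split.
- by move=> xy; exists x => //; apply: perp_sym.
- by move=> x0y; apply: perp_sym => //; apply: perp_parallel x0_x.
- by move=> xy; apply: perp_sym => //; apply: perp_parallel x_x0.
- by move=> x0y; exists x0 => //; apply: perp_sym.
Qed.

(** Being parallel to [y] amounts to being perpendicular to a perpendicular
    of [y], so it is enough to avoid twice as many perpendicularities. *)
Lemma exists_apart (l : seq M) :
  exists x : M, forall y, List.In y l -> ~ perp x y /\ ~ parallel x y.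
Proof.
pose g x := proj1_sig (constructive_indefinite_description _ (perp_ex x)).
have perp_g x : perp x (g x) := proj2_sig (constructive_indefinite_description _ _).
have [x avoid_x] := perp_avoid spaceM (List.app l (List.map g l)).
exists x => y l_y; split; first by apply/avoid_x/List.in_or_app; left.
move=> /parallelC /perp_parallel /(_ (perp_g y)).
by apply/avoid_x/List.in_or_app; right; apply: List.in_map.
Qed.

End PerpSpaceTheory.

(** * Finite partial isomorphisms *)

Definition same_position (M N : structure) (p q : M * N) : Prop :=
  [/\ p.1 = q.1 <-> p.2 = q.2, perp p.1 q.1 <-> perp p.2 q.2
    & parallel p.1 q.1 <-> parallel p.2 q.2].

Definition partial_iso (M N : structure) (s : seq (M * N)) : Prop :=
  forall p q, List.In p s -> List.In q s -> same_position p q.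

Definition swap (A B : Type) (p : A * B) : B * A := (p.2, p.1).

Lemma partial_iso_swap (M N : structure) (s : seq (M * N)) :
  partial_iso s -> partial_iso (List.map (@swap M N) s).
Proof.
move=> iso_s p q /List.in_map_iff[p' [<- s_p]] /List.in_map_iff[q' [<- s_q]].
by have [eqE perpE parE] := iso_s _ _ s_p s_q; split; apply: iff_sym.
Qed.

Section Extension.

Variables (M N : structure).
Hypotheses (spaceM : perp_space M) (spaceN : perp_space N).

Implicit Types (a c : M) (b : N) (s : seq (M * N)).

Lemma partial_iso_cons a b s : partial_iso s ->
    (forall q, List.In q s -> same_position (a, b) q) ->
  partial_iso ((a, b) :: s).
Proof.
move=> iso_s pos_ab p q /= [<-|s_p] [<-|s_q].
- split=> //=; first by split=> [/(perp_irr spaceM)|/(perp_irr spaceN)].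
  by split=> _; apply: parallel_refl.
- exact: pos_ab.
- have [/= eqE perpE parE] := pos_ab _ s_p; split=> /=.
  + by split=> /esym/eqE/esym.
  + by rewrite (perpC spaceM) (perpC spaceN).
  + by rewrite parallelC (parallelC p.2).
- exact: iso_s.
Qed.

(** Apart from equality, all relations of a line to the others are dictated by
    one perpendicular, so any fresh perpendicular to [b0] can correspond to
    [a]. *)
Lemma partial_iso_perp a a0 b0 s :
    partial_iso s -> List.In (a0, b0) s -> perp a a0 ->
    ~ List.In a (List.map fst s) ->
  exists b, partial_iso ((a, b) :: s).
Proof.
move=> iso_s s0 a_a0 new_a.
have [b b0_b new_b] := perp_fresh spaceN b0 (List.map snd s).
exists b; apply: partial_iso_cons => // q s_q.
have [_ /= perpE parE] := iso_s _ _ s0 s_q.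
have [aE1 aE2] := perp_position spaceM q.1 a_a0.
have [bE1 bE2] := perp_position spaceN q.2 (perp_sym spaceN b0_b).
split=> /=; first split=> eq_q.
- by case: new_a; rewrite eq_q; apply: List.in_map.
- by case: new_b; rewrite eq_q; apply: List.in_map.
- by rewrite aE1 bE1.
- by rewrite aE2 bE2.
Qed.

Lemma partial_iso_apart a s : partial_iso s ->
    (forall q, List.In q s -> ~ perp a q.1 /\ ~ parallel a q.1) ->
  exists b, partial_iso ((a, b) :: s).
Proof.
move=> iso_s apart_a.
have [b apart_b] := exists_apart spaceN (List.map snd s).
exists b; apply: partial_iso_cons => // q s_q.
have [Na Pa] := apart_a q s_q; have [Nb Pb] := apart_b q.2 (List.in_map snd _ _ s_q).
(* equal lines are parallel, so being apart rules out equality as well *)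
split=> //=; split=> eq_q.
  by case: Pa; rewrite -eq_q; apply: parallel_refl.
by case: Pb; rewrite -eq_q; apply: parallel_refl.
Qed.

(** When [a] is parallel to [a0], a common perpendicular [c] of both is
    adjoined first, which reduces to the case of perpendicular lines. *)
Lemma partial_iso_forth a s : partial_iso s ->
  exists s', [/\ partial_iso s', List.incl s s' & exists b, List.In (a, b) s'].
Proof.
move=> iso_s.
have addI b s1 : partial_iso ((a, b) :: s1) -> List.incl s s1 ->
    exists s', [/\ partial_iso s', List.incl s s' & exists b, List.In (a, b) s'].
  move=> iso1 le_s1; exists ((a, b) :: s1); split=> //; last by exists b; left.
  by move=> p /le_s1; right.
have [/List.in_map_iff[[_ b] [/= -> s_ab]]|new_a] :=
    classic (List.In a (List.map fst s)).
  by exists s; split=> //; exists b.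
have [[[a0 b0] [s0 /= a_a0]]|not_perp] :=
    classic (exists q, List.In q s /\ perp a q.1).
  have [b /addI] := partial_iso_perp iso_s s0 a_a0 new_a.
  by apply; apply: List.incl_refl.
have [[[a0 b0] [s0 /= [c a_c a0_c]]]|not_par] :=
    classic (exists q, List.In q s /\ parallel a q.1).
  have new_c : ~ List.In c (List.map fst s).
    case/List.in_map_iff=> q [def_c s_q].
    by case: not_perp; exists q; rewrite def_c.
  have [d iso_cd] := partial_iso_perp iso_s s0 (perp_sym spaceM a0_c) new_c.
  have [||b /addI] := @partial_iso_perp a c d _ iso_cd _ a_c; first by left.
    by case=> //= eq_ca; case: (@perp_irr _ spaceM a); rewrite -{2}eq_ca.
  by apply=> q; right.
have [|b /addI] := @partial_iso_apart a s iso_s.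
  by move=> q s_q; split=> [a_q|a_q]; [case: not_perp|case: not_par]; exists q.
by apply; apply: List.incl_refl.
Qed.

End Extension.

Lemma partial_iso_back (M N : structure) (b : N) (s : seq (M * N)) :
    perp_space M -> perp_space N -> partial_iso s ->
  exists s', [/\ partial_iso s', List.incl s s' & exists a, List.In (a, b) s'].
Proof.
move=> spaceM spaceN /partial_iso_swap iso_s.
have [s' [iso_s' le_ss' [a s'_ab]]] := partial_iso_forth spaceN spaceM b iso_s.
exists (List.map (@swap N M) s'); split; first exact: partial_iso_swap.
- move=> [x y] s_xy; apply/List.in_map_iff; exists (y, x); split=> //.
  by apply/le_ss'/List.in_map_iff; exists (x, y).
- by exists a; apply/List.in_map_iff; exists (b, a).
Qed.

(** * The back-and-forth method *)

(** The relation is the union of an increasing sequence of good finite partial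
    maps, the [n]-th step of which treats the [n]-th elements of both sides;
    any two of its pairs occur together at some stage. *)
Lemma back_and_forth (A B : Type) (e : nat -> A) (h : nat -> B)
    (good : seq (A * B) -> Prop) :
    (forall a, exists n, e n = a) -> (forall b, exists n, h n = b) ->
    good [::] ->
    (forall a s, good s -> exists s',
       [/\ good s', List.incl s s' & exists b, List.In (a, b) s']) ->
    (forall b s, good s -> exists s',
       [/\ good s', List.incl s s' & exists a, List.In (a, b) s']) ->
  exists R : A -> B -> Prop,
    [/\ forall a, exists b, R a b, forall b, exists a, R a b
      & forall a b a' b', R a b -> R a' b' ->
          exists s, [/\ good s, List.In (a, b) s & List.In (a', b') s]].
Proof.
move=> e_surj h_surj good0 forth back.
have step n (s : {s | good s}) : exists s' : {s | good s},
    [/\ List.incl (sval s) (sval s'), exists b, List.In (e n, b) (sval s')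
      & exists a, List.In (a, h n) (sval s')].
  case: s => s good_s; have [s1 [good1 le1 [b s1b]]] := forth (e n) s good_s.
  have [s2 [good2 le2 s2a]] := back (h n) s1 good1.
  exists (exist _ s2 good2); split=> //=; first exact: List.incl_tran le1 le2.
  by exists b; apply: le2.
pose next n s := proj1_sig (constructive_indefinite_description _ (step n s)).
pose S := fix S n := if n is m.+1 then next m (S m) else exist _ [::] good0.
have S_next n : [/\ List.incl (sval (S n)) (sval (S n.+1)),
    exists b, List.In (e n, b) (sval (S n.+1))
    & exists a, List.In (a, h n) (sval (S n.+1))].
  exact: (proj2_sig (constructive_indefinite_description _ (step n (S n)))).
have S_mono m n : m <= n -> List.incl (sval (S m)) (sval (S n)).
  move/subnKC <-; elim: (n - m) => [|k IHk].
    by rewrite addn0; apply: List.incl_refl.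
  by rewrite addnS; apply: List.incl_tran IHk _; have [] := S_next (m + k).
exists (fun a b => exists n, List.In (a, b) (sval (S n))); split.
- by move=> a; have [n <-] := e_surj a; have [_ [b Sb] _] := S_next n; exists b, n.+1.
- by move=> b; have [n <-] := h_surj b; have [_ _ [a Sa]] := S_next n; exists a, n.+1.
- move=> a b a' b' [m Sm] [n Sn]; exists (sval (S (maxn m n))); split.
  + exact: svalP.
  + by apply: S_mono Sm; apply: leq_maxl.
  + by apply: S_mono Sn; apply: leq_maxr.
Qed.

Lemma card_omega_surj (M : structure) :
  card_omega M -> exists e : nat -> M, forall a, exists n, e n = a.
Proof. by case=> e [g _ gK]; exists e => a; exists (g a). Qed.

Lemma perp_space_isomorphic (M N : structure) :
  card_omega M -> perp_space M -> card_omega N -> perp_space N -> isomorphic M N.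
Proof.
move=> /card_omega_surj[e e_surj] spaceM /card_omega_surj[h h_surj] spaceN.
have [|a s|b s|R [R_tot R_surj R_iso]] :=
    @back_and_forth _ _ e h (@partial_iso M N) e_surj h_surj.
- by [].
- exact: partial_iso_forth.
- exact: partial_iso_back.
have posR a b a' b' : R a b -> R a' b' -> same_position (a, b) (a', b').
  by move=> Rab /(R_iso _ _ _ _ Rab)[s [iso_s s_ab s_ab']]; apply: iso_s.
pose f a := proj1_sig (constructive_indefinite_description _ (R_tot a)).
pose g b := proj1_sig (constructive_indefinite_description _ (R_surj b)).
have Rf a : R a (f a).
  exact: proj2_sig (constructive_indefinite_description _ (R_tot a)).
have Rg b : R (g b) b.
  exact: proj2_sig (constructive_indefinite_description _ (R_surj b)).
exists f; split=> [|x y]; last by have [] := posR _ _ _ _ (Rf x) (Rf y).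
exists g => [a|b].
  by have [[_ inj_f] _ _] := posR _ _ _ _ (Rg (f a)) (Rf a); apply: inj_f.
by have [[fun_f _] _ _] := posR _ _ _ _ (Rf (g b)) (Rg b); apply: fun_f.
Qed.

(** * A countable model *)

(** The valuation is that of [n.+1], since [0] has none. *)
Definition valuation_class (n : nat) : nat := logn 2 n.+1.

Definition valuation_perp (m n : nat) : Prop :=
  (valuation_class m)./2 = (valuation_class n)./2 /\
  odd (valuation_class m) <> odd (valuation_class n).

Definition valuation_model : structure := Structure valuation_perp.

(** The odd multiples of [2 ^ k] are the numbers of valuation [k], up to the
    shift by one. *)
Lemma valuation_class_unbounded k j :
  exists2 n, valuation_class n = k & j <= n.
Proof.
have pos : 0 < 2 ^ k * j.*2.+1 by rewrite muln_gt0 expn_gt0.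
exists (2 ^ k * j.*2.+1).-1.
  rewrite /valuation_class prednK // lognM ?expn_gt0 // pfactorK //.
  by rewrite logn_coprime ?addn0 // coprime2n /= odd_double.
rewrite -ltnS prednK //; apply: leq_trans (leq_pmull _ _); last by rewrite expn_gt0.
by rewrite ltnS -addnn leq_addr.
Qed.

Lemma valuation_model_sat : models valuation_model SAPP.
Proof.
have perp_above s j : exists2 t, valuation_perp s t & j <= t.
  set k := valuation_class s.
  have [t def_t le_jt] := valuation_class_unbounded (~~ odd k + k./2.*2) j.
  exists t => //; rewrite /valuation_perp def_t half_bit_double; split=> //.
  by rewrite oddD odd_double addbF oddb -/k; case: (odd k).
have bounded (f : nat -> nat) n : exists m, forall i, i <= n -> f i < m.
  exists (\max_(i < n.+1) f i).+1 => i le_in; rewrite ltnS.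
  exact: (leq_bigmax (Ordinal (le_in : i < n.+1))).
move=> p [n n_gt0|n n_ge2||||] v.
- apply: sat_alls_intro => w s _; have [m lt_m] := bounded w n.
  have [t st le_mt] := perp_above s m; exists t; split; last first.
    by rewrite /= /update !eqxx /=.
  apply/sat_conjs => // i /andP[i_gt0 le_in] /=.
  rewrite /update !eqxx ltn_eqF ?ltnS // eqn0Ngt i_gt0 /= => def_t.
  by have := lt_m i le_in; rewrite -def_t ltnNge le_mt.
- apply: sat_alls_intro => w.
  have [m lt_m] := bounded (fun i => (valuation_class (w i))./2) n.
  have [s def_s _] := valuation_class_unbounded m.*2 0.
  exists s; apply/sat_conjs => [|i /andP[i_gt0 le_in]]; first exact: ltnW.
  rewrite /= /update /= eqn0Ngt i_gt0 /= /valuation_perp def_s doubleK => -[def_m _].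
  by have := lt_m i le_in; rewrite -def_m ltnn.
- by move=> x [].
- by move=> x y [/= eq_h neq_o]; split=> // /esym.
- by move=> x; have [y xy _] := perp_above x 0; exists y.
- move=> x y z t [[]]; rewrite /= /update /= => -[xz oxz] [yz oyz] [xt oxt].
  split; first by rewrite yz -xz.
  by move: oxz oyz oxt; do 4!case: odd.
Qed.

Theorem proposition4p2 : omega_categorical SAPP.
Proof.
split.
  exists valuation_model; split; last exact: valuation_model_sat.
  by exists id; exists id.
move=> M N omM satM omN satN.
by apply: perp_space_isomorphic => //; apply: models_perp_space.
Qed.
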